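(* Let $K$ be a field of characteristic zero, $n\geq 1$, and $k\in K^n$. Then the $n$th hom-associative Weyl algebra $A_n^k$ over $K$ is simple.
   Context: The $n$th Weyl algebra $A_n$ over $K$ is the free associative unital $K$-algebra on $x_1,\ldots,x_n,y_1,\ldots,y_n$ modulo the relations $[x_i,x_j]=[y_i,y_j]=0$ and $[x_i,y_j]=\delta_{ij}$ (Kronecker delta, times $1_{A_n}$) for $1\le i,j\le n$. For $k=(k_1,\ldots,k_n)\in K^n$, let $\widehat\alpha_k\colon A_n\to A_n$ be the unital $K$-algebra endomorphism with $\widehat\alpha_k(x_\ell)=x_\ell$ and $\widehat\alpha_k(y_\ell)=y_\ell+k_\ell$ for $1\le\ell\le n$. The $n$th hom-associative Weyl algebra $A_n^k$ is the $K$-vector space $A_n$ equipped with the (in general nonassociative, nonunital) multiplication $p*q:=\widehat\alpha_k(pq)$ (where $pq$ is the product in $A_n$) and with twisting map $\widehat\alpha_k$. An ideal $I$ of a nonassociative $K$-algebra $A$ is an additive subgroup with $KI, IK, AI, IA\subseteq I$. $A$ is simple if $\{0\}$ and $A$ are its only ideals. *)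

(* Defs.v *)
From HB Require Import structures.
From mathcomp Require Import all_boot all_order all_algebra.
From mathcomp Require Import generic_quotient ring_quotient finmap.
From mathcomp Require Import boolp classical_sets.
From mathcomp.multinomials Require Import monalg.

Set Implicit Arguments.
Unset Strict Implicit.
Unset Printing Implicit Defensive.

Import GRing.Theory.
Local Open Scope ring_scope.
Local Open Scope quotient_scope.
Local Open Scope classical_set_scope.

Section Ideals.
Context (K : pzRingType) (V : lmodType K) (mul : V -> V -> V).

(* [mul] is an arbitrary product on V: neither associativity nor a unit is
   assumed, so stability under scalars has to be required. *)
Definition is_ideal (I : set V) : Prop :=
  [/\ I 0, forall a b, I a -> I b -> I (a - b),
      forall c a, I a -> I (c *: a)
    & forall a b, I b -> I (mul a b) /\ I (mul b a)].

End Ideals.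

HB.mixin Record Lmodule_isHomAlgebra (K : pzRingType) V of GRing.Lmodule K V := {
  hmul : V -> V -> V;
  twist : V -> V;
  hmulDl : left_distributive hmul +%R;
  hmulDr : right_distributive hmul +%R;
  hmulZl : forall c a b, hmul (c *: a) b = c *: hmul a b;
  hmulZr : forall c a b, hmul a (c *: b) = c *: hmul a b;
  twist_linear : linear twist;
  hom_assoc : forall a b c, hmul (twist a) (hmul b c) = hmul (hmul a b) (twist c)
}.

#[short(type="homAlgType")]
HB.structure Definition HomAlgebra (K : pzRingType) :=
  {V of GRing.Lmodule K V & Lmodule_isHomAlgebra K V}.

(* The zero algebra is not excluded here; A_n below is an nzRingType, hence
   nonzero. *)
Definition is_simple (K : pzRingType) (A : homAlgType K) : Prop :=
  forall I : set A, is_ideal hmul I -> I = [set 0] \/ I = [set: A].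

Lemma malg_scalerAr (K : comNzRingType) (M : monomType) c (p q : {malg K[M]}) :
  c *: (p * q) = p * (c *: q).
Proof.
have supp_le : (msupp (c *: q) `<=` msupp q)%fset by exact: msuppZ_le.
rewrite [p * q]malgME [RHS](malgMEw (fsubset_refl _) supp_le) scaler_sumr.
apply: eq_bigr => u _; rewrite scaler_sumr; apply: eq_bigr => v _.
apply/malgP => w; rewrite [LHS]mcoeffZ [in LHS]mcoeffU [RHS]mcoeffU.
by rewrite [(c *: q)@_v]mcoeffZ mulrnAr mulrCA.
Qed.

(* The free associative unital K-algebra on T: noncommutative polynomials. *)
Definition freeAlg (K : comNzRingType) (T : choiceType) : Type :=
  {malg K[{fmonom T}]}.

HB.instance Definition _ (K : comNzRingType) (T : choiceType) :=
  GRing.Lmodule.copy (freeAlg K T) {malg K[{fmonom T}]}.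

(* Locked so that failed conversions do not unfold the convolution product. *)
HB.lock Definition free_mul (K : comNzRingType) (T : choiceType)
  (p q : freeAlg K T) : freeAlg K T := (p : {malg K[{fmonom T}]}) * q.

Section FreeAlg.
Context (K : comNzRingType) (T : choiceType).
Local Notation F := (freeAlg K T).
Local Notation mul := (@free_mul K T).
Local Notation one := (1 : {malg K[{fmonom T}]}).

Fact free_mulA : associative mul.
Proof. by rewrite unlock => p q r; exact: mulrA. Qed.

Fact free_mul1 : left_id (one : F) mul.
Proof. by rewrite unlock => p; exact: mul1r. Qed.

Fact free_mulr1 : right_id (one : F) mul.
Proof. by rewrite unlock => p; exact: mulr1. Qed.

Fact free_mulDl : left_distributive mul +%R.
Proof. by rewrite unlock => p q r; exact: mulrDl. Qed.

Fact free_mulDr : right_distributive mul +%R.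
Proof. by rewrite unlock => p q r; exact: mulrDr. Qed.

Fact free_oner_neq0 : (one : F) != 0.
Proof. exact: oner_neq0. Qed.

HB.instance Definition _ := GRing.Zmodule_isNzRing.Build F
  free_mulA free_mul1 free_mulr1 free_mulDl free_mulDr free_oner_neq0.

Fact free_scaleAl c (p q : F) : c *: mul p q = mul (c *: p) q.
Proof. by rewrite unlock; exact: scalerAl. Qed.

HB.instance Definition _ := GRing.Lmodule_isLalgebra.Build K F free_scaleAl.

Fact free_scaleAr c (p q : F) : c *: mul p q = mul p (c *: q).
Proof. by rewrite unlock; exact: malg_scalerAr. Qed.

HB.instance Definition _ := GRing.Lalgebra_isAlgebra.Build K F free_scaleAr.

Lemma freeAlg_mulE (p q : F) : p * q = (p : {malg K[{fmonom T}]}) * q.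
Proof. by rewrite /GRing.mul /= unlock. Qed.

End FreeAlg.

HB.lock Definition free_gen (K : comNzRingType) (T : choiceType) (t : T) :
  freeAlg K T := << 1 *g fmu t >>.

Section FreeLift.
Context (K : comNzRingType) (T : choiceType).
Local Notation F := (freeAlg K T).
Context (B : algType K) (h : T -> B).

Definition monom_eval (w : {fmonom T}) : B := \prod_(t <- (w : seq T)) h t.

Lemma monom_eval_mmorphism : mmorphism monom_eval.
Proof.
by split=> [u v|]; rewrite /monom_eval ?fm1 ?big_nil // fmM big_cat.
Qed.

HB.instance Definition _ :=
  isMultiplicative.Build {fmonom T} B monom_eval monom_eval_mmorphism.

Definition free_lift (p : F) : B := mmap (in_alg B) monom_eval p.

Lemma free_lift_is_zmod_morphism : zmod_morphism free_lift.
Proof. exact: mmap_is_additive. Qed.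

HB.instance Definition _ :=
  GRing.isZmodMorphism.Build F B free_lift free_lift_is_zmod_morphism.

Lemma free_lift_is_monoid_morphism : monoid_morphism free_lift.
Proof.
have [fM f1] : multiplicative (mmap (in_alg B) monom_eval).
  apply: commr_mmap_is_multiplicative => g m m'.
  by rewrite /GRing.comm /= mulr_algl mulr_algr.
by split=> [|p q]; [exact: f1 | rewrite freeAlg_mulE; exact: fM].
Qed.

HB.instance Definition _ :=
  GRing.isMonoidMorphism.Build F B free_lift free_lift_is_monoid_morphism.

Lemma free_lift_is_scalable : scalable free_lift.
Proof. by move=> c p; rewrite /free_lift mmapZ /= mulr_algl. Qed.

HB.instance Definition _ :=
  GRing.isScalable.Build K F B *:%R free_lift free_lift_is_scalable.

Lemma free_lift_gen t : free_lift (free_gen K t) = h t.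
Proof.
by rewrite /free_lift unlock mmapU /= scale1r mul1r /monom_eval fmU big_seq1.
Qed.

End FreeLift.

Section Weyl.
Context (K : fieldType) (n : nat).

Local Notation F := (freeAlg K ('I_n + 'I_n)%type).
Local Notation X i := (free_gen K (inl i : 'I_n + 'I_n)%type).
Local Notation Y i := (free_gen K (inr i : 'I_n + 'I_n)%type).

Inductive weyl_rel : set F :=
| Weyl_xx i j : weyl_rel (X i * X j - X j * X i)
| Weyl_yy i j : weyl_rel (Y i * Y j - Y j * Y i)
| Weyl_xy i j : weyl_rel (X i * Y j - Y j * X i - (i == j)%:R).

Definition weyl_ideal : set F := smallest (is_ideal *%R) weyl_rel.

Lemma weyl_ideal_is_ideal : is_ideal *%R weyl_ideal.
Proof.
split=> [I [[]] // | a b Ia Ib I II | c a Ia I II | a b Ib].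
- by case: (II) => [[_ IB _ _] _]; apply: IB; [apply: Ia | apply: Ib].
- by case: (II) => [[_ _ IZ _] _]; apply: IZ; apply: Ia.
- by split=> I II; case: (II) => [[_ _ _ IM] _];
    case: (IM a b (Ib _ II)).
Qed.

Lemma weyl_ideal0 : weyl_ideal 0.
Proof. by have [] := weyl_ideal_is_ideal. Qed.

Lemma weyl_idealB p q : weyl_ideal p -> weyl_ideal q -> weyl_ideal (p - q).
Proof. by have [_ IB _ _] := weyl_ideal_is_ideal; exact: IB. Qed.

Lemma weyl_idealN p : weyl_ideal p -> weyl_ideal (- p).
Proof. by rewrite -sub0r; apply: weyl_idealB; exact: weyl_ideal0. Qed.

Lemma weyl_idealZ c p : weyl_ideal p -> weyl_ideal (c *: p).
Proof. by have [_ _ IZ _] := weyl_ideal_is_ideal; exact: IZ. Qed.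

Lemma weyl_idealMl p q : weyl_ideal q -> weyl_ideal (p * q).
Proof. by have [_ _ _ IM] := weyl_ideal_is_ideal; move=> /(IM p)[]. Qed.

Lemma weyl_idealMr p q : weyl_ideal p -> weyl_ideal (p * q).
Proof. by have [_ _ _ IM] := weyl_ideal_is_ideal; move=> /(IM q)[]. Qed.

Lemma weyl_rel_sub : weyl_rel `<=` weyl_ideal.
Proof. exact: sub_gen_smallest. Qed.

Definition weyl_pred : {pred F} := fun p => p \in weyl_ideal.

Lemma weyl_predP p : reflect (weyl_ideal p) (p \in weyl_pred).
Proof. by apply: (iffP idP); rewrite [_ \in weyl_pred]/(p \in _) inE. Qed.

Lemma weyl_pred_zmod_closed : zmod_closed weyl_pred.
Proof.
split=> [|a b /weyl_predP Ia /weyl_predP Ib]; apply/weyl_predP.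
  exact: weyl_ideal0.
exact: weyl_idealB.
Qed.

HB.instance Definition _ :=
  GRing.isZmodClosed.Build F weyl_pred weyl_pred_zmod_closed.

(* Properness of the ideal: F acts on functions f of a multi-index m by
   x_i f (m) = f (m + e_i) and y_i f (m) = m_i f (m - e_i). *)
Local Notation idx := {ffun 'I_n -> nat}.

Definition idx_incr i (m : idx) : idx := [ffun j => m j + (i == j)]%N.
Definition idx_decr i (m : idx) : idx := [ffun j => m j - (i == j)]%N.

Definition weyl_step (t : 'I_n + 'I_n) (f : idx -> K) : idx -> K :=
  match t with
  | inl i => fun m => f (idx_incr i m)
  | inr i => fun m => (m i)%:R * f (idx_decr i m)
  end.

Definition weyl_act (p : F) (f : idx -> K) (m : idx) : K :=
  mmap idfun (fun w : {fmonom ('I_n + 'I_n)%type} =>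
    foldr weyl_step f (w : seq _) m) p.

Lemma weyl_step_sum (T : Type) (r : seq T) (c : T -> K) (g : T -> idx -> K) s :
  foldr weyl_step (fun m => \sum_(k <- r) c k * g k m) s =
  fun m => \sum_(k <- r) c k * foldr weyl_step (g k) s m.
Proof.
elim: s => //= t s ->; apply/funext => m; case: t => i //=.
by rewrite mulr_sumr; apply: eq_bigr => k _; rewrite mulrCA.
Qed.

Lemma weyl_actB p q f m : weyl_act (p - q) f m = weyl_act p f m - weyl_act q f m.
Proof. exact: raddfB. Qed.

Lemma weyl_actZ c p f m : weyl_act (c *: p) f m = c * weyl_act p f m.
Proof.
rewrite /weyl_act (mmapEw (msuppZ_le _ _)) mmapE mulr_sumr.
by apply: eq_bigr => w _; rewrite [(c *: p)@_w]mcoeffZ /= mulrA.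
Qed.

Lemma weyl_actM p q f : weyl_act (p * q) f = weyl_act p (weyl_act q f).
Proof.
apply/funext => m; rewrite freeAlg_mulE /weyl_act malgME raddf_sum /= mmapE.
apply: eq_bigr => u _; rewrite raddf_sum /=.
rewrite [S in _ * S](congr1 (@^~ m) (weyl_step_sum _ _ _ _)) mulr_sumr; apply: eq_bigr => v _.
by rewrite mmapU /= fmM foldr_cat mulrA.
Qed.

Lemma weyl_act_gen t f : weyl_act (free_gen K t) f = weyl_step t f.
Proof. by apply/funext => m; rewrite /weyl_act unlock mmapU /= fmU mul1r. Qed.

Lemma weyl_act1 f m : weyl_act 1 f m = f m.
Proof. by apply: (etrans (mmapU _ _)) => /=; rewrite fm1 mul1r. Qed.

Lemma weyl_act_commr p q f m :
  weyl_act (p * q - q * p) f m =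
  weyl_act p (weyl_act q f) m - weyl_act q (weyl_act p f) m.
Proof.
apply: (etrans (weyl_actB (p * q) (q * p) f m)).
exact: (congr2 (fun a b => a m - b m) (weyl_actM p q f) (weyl_actM q p f)).
Qed.

Lemma weyl_act_comm t u f m :
  weyl_act (free_gen K t * free_gen K u - free_gen K u * free_gen K t) f m =
  weyl_step t (weyl_step u f) m - weyl_step u (weyl_step t f) m.
Proof.
have actE v w : weyl_act (free_gen K v) (weyl_act (free_gen K w) f) =
    weyl_step v (weyl_step w f) by rewrite (weyl_act_gen w f) weyl_act_gen.
by rewrite -(actE t) -(actE u); exact: weyl_act_commr.
Qed.

Lemma weyl_act_nat d f m : weyl_act d%:R f m = d%:R * f m.
Proof.
rewrite -(weyl_act1 f m); elim: d => [|d IHd].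
  by rewrite mul0r; exact: raddf0.
rewrite -[d.+1%:R in RHS]natr1 mulrDl mul1r -IHd -natr1.
exact: raddfD.
Qed.

Lemma weyl_rel_act p f m : weyl_rel p -> weyl_act p f m = 0.
Proof.
case=> i j.
- rewrite weyl_act_comm /=; apply/eqP; rewrite subr_eq0; apply/eqP; congr f.
  by apply/ffunP => l; rewrite !ffunE addnAC.
- rewrite weyl_act_comm /=.
  have [-> | neq_ij] := eqVneq i j; first by rewrite subrr.
  rewrite !ffunE (negPf neq_ij) eq_sym (negPf neq_ij) !subn0 mulrCA.
  apply/eqP; rewrite subr_eq0; apply/eqP; congr (_ * (_ * f _)).
  by apply/ffunP => l; rewrite !ffunE subnAC.
apply: (etrans (weyl_actB _ _ f m)); rewrite weyl_act_nat.
rewrite [S in S - _]weyl_act_comm /=.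
have [-> | neq_ij] := eqVneq i j; rewrite !ffunE; last first.
  rewrite mul0r subr0 (negPf neq_ij) addn0.
  apply/eqP; rewrite subr_eq0; apply/eqP; congr (_ * f _).
  apply/ffunP => l; rewrite !ffunE.
  have [<-|_] := eqVneq i l; last by rewrite !addn0.
  by rewrite eq_sym (negPf neq_ij) !subn0.
rewrite mul1r eqxx addn1.
have -> : idx_decr j (idx_incr j m) = m.
  by apply/ffunP => l; rewrite !ffunE addnK.
case mj: (m j) => [|d]; first by rewrite mul1r mul0r subr0 subrr.
have -> : idx_incr j (idx_decr j m) = m.
  apply/ffunP => l; rewrite !ffunE subnK //.
  by have [<-|//] := eqVneq j l; rewrite mj.
by rewrite -mulrBl -natrB // subSnn mul1r subrr.
Qed.

Lemma weyl_ideal_proper : ~ weyl_ideal 1.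
Proof.
pose J : set F := [set p | forall f m, weyl_act p f m = 0].
have act0 q : weyl_act q (fun=> 0) = fun=> 0.
  apply/funext => m; rewrite /weyl_act mmapE big1 // => u _.
  have -> : foldr weyl_step (fun=> 0) u = fun=> 0.
    elim: (u : seq _) => //= -[] i s -> //=.
    by apply/funext => m'; rewrite mulr0.
  by rewrite mulr0.
have JI : is_ideal *%R J.
  split=> [f m | a b Ja Jb f m | c a Ja f m | a b Jb].
  - exact: raddf0.
  - by rewrite weyl_actB Ja Jb subrr.
  - by rewrite weyl_actZ Ja mulr0.
  - split=> f m; rewrite weyl_actM ?Jb //.
    by rewrite (_ : weyl_act b f = fun=> 0) ?act0 //; apply/funext => m'.
move=> /(_ J) J1; have {J1} : J 1 by apply: J1; split=> // p pr f m; exact: weyl_rel_act.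
by move=> /(_ (fun=> 1) [ffun=> 0%N])/eqP; rewrite weyl_act1 oner_eq0.
Qed.

Definition weyl : Type := Quotient.quot weyl_pred.

HB.instance Definition _ := GRing.Zmodule.on weyl.

Definition weyl_pi (p : F) : weyl := \pi_(Quotient.quot weyl_pred) p.
Definition weyl_repr (a : weyl) : F := repr (a : Quotient.quot weyl_pred).

Lemma weyl_reprK a : weyl_pi (weyl_repr a) = a.
Proof. exact: reprK. Qed.

Lemma weyl_pi_zmod_morphism : zmod_morphism weyl_pi.
Proof. exact: (raddfB (\pi_(Quotient.quot weyl_pred))). Qed.

HB.instance Definition _ :=
  GRing.isZmodMorphism.Build F weyl weyl_pi weyl_pi_zmod_morphism.

Lemma weyl_piP p q : weyl_pi p = weyl_pi q <-> weyl_ideal (p - q).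
Proof.
rewrite /weyl_pi; split=> [pq|/weyl_predP pq].
  by apply/weyl_predP; rewrite Quotient.idealrBE pq.
by apply/eqP; rewrite -Quotient.idealrBE.
Qed.

Lemma weyl_ideal_repr p : weyl_ideal (weyl_repr (weyl_pi p) - p).
Proof. by apply/weyl_piP; rewrite weyl_reprK. Qed.

End Weyl.

HB.lock Definition weyl_mul (K : fieldType) (n : nat) (a b : weyl K n) :
  weyl K n := weyl_pi (weyl_repr a * weyl_repr b).
HB.lock Definition weyl_scale (K : fieldType) (n : nat) (c : K) (a : weyl K n) :
  weyl K n := weyl_pi (c *: weyl_repr a).

Section WeylAlgebra.
Context (K : fieldType) (n : nat).

Local Notation F := (freeAlg K ('I_n + 'I_n)%type).
Local Notation X i := (free_gen K (inl i : 'I_n + 'I_n)%type).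
Local Notation Y i := (free_gen K (inr i : 'I_n + 'I_n)%type).
Local Notation weyl := (weyl K n).
Local Notation weyl_pi := (@weyl_pi K n).
Local Notation weyl_scale := (@weyl_scale K n).
Local Notation weyl_mul := (@weyl_mul K n).

Let weyl_one : weyl := weyl_pi 1.

Lemma weyl_piM p q : weyl_pi (p * q) = weyl_mul (weyl_pi p) (weyl_pi q).
Proof.
rewrite unlock; apply/esym/weyl_piP; set p' := weyl_repr (_ p); set q' := weyl_repr (_ q).
have -> : p' * q' - p * q = p' * (q' - q) - (- (p' - p)) * q.
  by rewrite mulNr opprK mulrBr mulrBl addrA subrK.
apply: (weyl_idealB (weyl_idealMl p' (weyl_ideal_repr q))).
exact: (weyl_idealMr q (weyl_idealN (weyl_ideal_repr p))).
Qed.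

Lemma weyl_piZ c p : weyl_pi (c *: p) = weyl_scale c (weyl_pi p).
Proof.
rewrite unlock; apply/esym/weyl_piP; rewrite -scalerBr.
exact: (weyl_idealZ c (weyl_ideal_repr p)).
Qed.

Lemma weyl_piPn (P : weyl -> Prop) : (forall p, P (weyl_pi p)) -> forall a, P a.
Proof. by move=> Ppi a; rewrite -[a]weyl_reprK. Qed.

Fact weyl_mulA : associative weyl_mul.
Proof.
elim/weyl_piPn=> p; elim/weyl_piPn=> q; elim/weyl_piPn=> r.
by rewrite -!weyl_piM mulrA.
Qed.

Fact weyl_mul1 : left_id weyl_one weyl_mul.
Proof. by elim/weyl_piPn=> p; rewrite -weyl_piM mul1r. Qed.

Fact weyl_mulr1 : right_id weyl_one weyl_mul.
Proof. by elim/weyl_piPn=> p; rewrite -weyl_piM mulr1. Qed.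

Fact weyl_mulDl : left_distributive weyl_mul +%R.
Proof.
elim/weyl_piPn=> p; elim/weyl_piPn=> q; elim/weyl_piPn=> r.
by rewrite -raddfD -!weyl_piM mulrDl raddfD.
Qed.

Fact weyl_mulDr : right_distributive weyl_mul +%R.
Proof.
elim/weyl_piPn=> p; elim/weyl_piPn=> q; elim/weyl_piPn=> r.
by rewrite -raddfD -!weyl_piM mulrDr raddfD.
Qed.

Fact weyl_oner_neq0 : weyl_one != 0.
Proof.
apply/eqP; rewrite -[RHS](raddf0 weyl_pi) => /weyl_piP.
by rewrite subr0; exact: weyl_ideal_proper.
Qed.

HB.instance Definition _ := GRing.Zmodule_isNzRing.Build weyl
  weyl_mulA weyl_mul1 weyl_mulr1 weyl_mulDl weyl_mulDr weyl_oner_neq0.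

Fact weyl_scaleA c d a : weyl_scale c (weyl_scale d a) = weyl_scale (c * d) a.
Proof. by elim/weyl_piPn: a => p; rewrite -!weyl_piZ scalerA. Qed.

Fact weyl_scale1 : left_id 1 weyl_scale.
Proof. by elim/weyl_piPn=> p; rewrite -weyl_piZ scale1r. Qed.

Fact weyl_scaleDr : right_distributive weyl_scale +%R.
Proof.
move=> c; elim/weyl_piPn=> p; elim/weyl_piPn=> q.
by rewrite -raddfD -!weyl_piZ scalerDr raddfD.
Qed.

Fact weyl_scaleDl a : {morph weyl_scale^~ a : c d / c + d}.
Proof.
by elim/weyl_piPn: a => p c d; rewrite -!weyl_piZ scalerDl raddfD.
Qed.

HB.instance Definition _ := GRing.Zmodule_isLmodule.Build K weyl
  weyl_scaleA weyl_scale1 weyl_scaleDr weyl_scaleDl.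

Fact weyl_scaleAl c a b :
  weyl_scale c (weyl_mul a b) = weyl_mul (weyl_scale c a) b.
Proof.
elim/weyl_piPn: a => p; elim/weyl_piPn: b => q.
by rewrite -weyl_piZ -!weyl_piM -weyl_piZ scalerAl.
Qed.

HB.instance Definition _ := GRing.Lmodule_isLalgebra.Build K weyl weyl_scaleAl.

Fact weyl_scaleAr c a b :
  weyl_scale c (weyl_mul a b) = weyl_mul a (weyl_scale c b).
Proof.
elim/weyl_piPn: a => p; elim/weyl_piPn: b => q.
by rewrite -weyl_piZ -!weyl_piM -weyl_piZ scalerAr.
Qed.

HB.instance Definition _ := GRing.Lalgebra_isAlgebra.Build K weyl weyl_scaleAr.

Lemma weyl_pi_monoid_morphism : monoid_morphism weyl_pi.
Proof. by split=> // p q; exact: weyl_piM. Qed.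

HB.instance Definition _ :=
  GRing.isMonoidMorphism.Build F weyl weyl_pi weyl_pi_monoid_morphism.

Lemma weyl_pi_scalable : scalable weyl_pi.
Proof. by move=> c p; exact: weyl_piZ. Qed.

HB.instance Definition _ :=
  GRing.isScalable.Build K F weyl *:%R weyl_pi weyl_pi_scalable.

End WeylAlgebra.

HB.lock Definition weyl_x (K : fieldType) (n : nat) (i : 'I_n) : weyl K n :=
  weyl_pi (free_gen K (inl i : 'I_n + 'I_n)%type).
HB.lock Definition weyl_y (K : fieldType) (n : nat) (i : 'I_n) : weyl K n :=
  weyl_pi (free_gen K (inr i : 'I_n + 'I_n)%type).

Section WeylRelations.
Context (K : fieldType) (n : nat).
Local Notation weyl_pi := (@weyl_pi K n).
Local Notation weyl_x := (weyl_x K).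
Local Notation weyl_y := (weyl_y K).

Lemma weyl_pi_rel p : weyl_rel p -> weyl_pi p = 0.
Proof.
move=> /weyl_rel_sub pI; rewrite -(raddf0 weyl_pi).
by apply/weyl_piP; rewrite subr0.
Qed.

Lemma weyl_xxC i j : weyl_x i * weyl_x j - weyl_x j * weyl_x i = 0 :> weyl K n.
Proof.
rewrite unlock -!rmorphM -rmorphB; apply: weyl_pi_rel.
exact: Weyl_xx.
Qed.

Lemma weyl_yyC i j : weyl_y i * weyl_y j - weyl_y j * weyl_y i = 0 :> weyl K n.
Proof.
rewrite unlock -!rmorphM -rmorphB; apply: weyl_pi_rel.
exact: Weyl_yy.
Qed.

Lemma weyl_xyC i j :
  weyl_x i * weyl_y j - weyl_y j * weyl_x i = (i == j)%:R :> weyl K n.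
Proof.
apply/eqP; rewrite -subr_eq0; apply/eqP.
rewrite weyl_x.unlock weyl_y.unlock -(rmorph_nat weyl_pi) -!rmorphM -!rmorphB.
by apply: weyl_pi_rel; exact: Weyl_xy.
Qed.

End WeylRelations.

Section HomWeyl.
Context (K : fieldType) (n : nat) (k : 'rV[K]_n).
Local Notation F := (freeAlg K ('I_n + 'I_n)%type).
Local Notation A := (weyl K n).

Definition twist_gen (t : 'I_n + 'I_n) : A :=
  match t with
  | inl l => weyl_x K l
  | inr l => weyl_y K l + (k 0 l)%:A
  end.

Lemma comm_shift (R : pzRingType) (u v a b : R) :
    a * v = v * a -> u * b = b * u -> a * b = b * a ->
  (u + a) * (v + b) - (v + b) * (u + a) = u * v - v * u.
Proof.
move=> av ub ab; rewrite !mulrDl !mulrDr av ub ab.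
rewrite (addrACA (v * u)) -(addrA (u * v)) -(addrA (v * u)).
by rewrite (addrC (v * u)) addrKA.
Qed.

Lemma free_twist_ideal (p : F) : weyl_ideal p -> free_lift twist_gen p = 0.
Proof.
pose J : set F := [set q | free_lift twist_gen q = 0].
have JI : is_ideal *%R J.
  split=> [|a b Ja Jb|c a Ja|a b Jb]; rewrite /J /=.
  - exact: raddf0.
  - by rewrite raddfB [S in S - _]Ja [S in _ - S]Jb subrr.
  - by rewrite linearZ_LR /= [S in _ *: S]Ja scaler0.
  - by rewrite !rmorphM /= [free_lift _ b]Jb mulr0 mul0r.
suff relJ : @weyl_rel K n `<=` J by move=> /(_ J); exact.
move=> q [] i j; rewrite /J /= !rmorphB !rmorphM /=;
  rewrite !free_lift_gen /=.
- exact: weyl_xxC.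
- have algC c (z : A) : c%:A * z = z * c%:A by rewrite mulr_algl mulr_algr.
  by rewrite (comm_shift (algC _ _) (esym (algC _ _)) (algC _ _)) weyl_yyC.
rewrite rmorph_nat -weyl_xyC mulrDr mulrDl mulr_algl mulr_algr.
by rewrite (addrC (weyl_y K j * _)) addrKA subrr.
Qed.

End HomWeyl.

(* The endomorphism of A_n with x_l |-> x_l and y_l |-> y_l + k_l. It does not
   depend on the chosen representative, by weyl_twist_pi. *)
HB.lock Definition weyl_twist (K : fieldType) (n : nat) (k : 'rV[K]_n)
  (a : weyl K n) : weyl K n := free_lift (twist_gen k) (weyl_repr a).

Section HomWeyl.
Context (K : fieldType) (n : nat) (k : 'rV[K]_n).
Local Notation A := (weyl K n).
Local Notation twist_gen := (twist_gen k).
Local Notation weyl_twist := (weyl_twist k).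

Lemma weyl_twist_pi p : weyl_twist (weyl_pi p) = free_lift twist_gen p.
Proof.
rewrite unlock; apply/eqP; rewrite -subr_eq0 -raddfB; apply/eqP.
by apply: free_twist_ideal; exact: weyl_ideal_repr.
Qed.

Lemma weyl_twist_zmod_morphism : zmod_morphism weyl_twist.
Proof.
elim/weyl_piPn=> p; elim/weyl_piPn=> q.
by rewrite -raddfB !weyl_twist_pi raddfB.
Qed.

HB.instance Definition _ :=
  GRing.isZmodMorphism.Build A A weyl_twist weyl_twist_zmod_morphism.

Lemma weyl_twist_monoid_morphism : monoid_morphism weyl_twist.
Proof.
split; first by rewrite -(rmorph1 (@weyl_pi K n)) weyl_twist_pi !rmorph1.
elim/weyl_piPn=> p; elim/weyl_piPn=> q.
by rewrite -rmorphM !weyl_twist_pi rmorphM.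
Qed.

HB.instance Definition _ :=
  GRing.isMonoidMorphism.Build A A weyl_twist weyl_twist_monoid_morphism.

Lemma weyl_twist_scalable : scalable weyl_twist.
Proof.
move=> c; elim/weyl_piPn=> p.
by rewrite -linearZ !weyl_twist_pi linearZ.
Qed.

HB.instance Definition _ :=
  GRing.isScalable.Build K A A *:%R weyl_twist weyl_twist_scalable.

Lemma weyl_twist_x l : weyl_twist (weyl_x K l) = weyl_x K l.
Proof. by rewrite weyl_x.unlock weyl_twist_pi free_lift_gen /= unlock. Qed.

Lemma weyl_twist_y l : weyl_twist (weyl_y K l) = weyl_y K l + (k 0 l)%:A.
Proof. by rewrite weyl_y.unlock weyl_twist_pi free_lift_gen /= unlock. Qed.

End HomWeyl.

(* The n-th hom-associative Weyl algebra A_n^k: an alias of A_n as a vector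
   space, so that its product does not clash with that of A_n. *)
Definition homWeyl (K : fieldType) (n : nat) (k : 'rV[K]_n) : Type := weyl K n.

HB.instance Definition _ (K : fieldType) (n : nat) (k : 'rV[K]_n) :=
  GRing.Lmodule.copy (homWeyl k) (weyl K n).

Section HomWeylAlgebra.
Context (K : fieldType) (n : nat) (k : 'rV[K]_n).
Local Notation A := (weyl K n).
Local Notation weyl_twist := (weyl_twist k).
Local Notation homWeyl := (homWeyl k).

Definition homWeyl_mul (p q : homWeyl) : homWeyl :=
  weyl_twist ((p : A) * (q : A)).

Fact homWeyl_mulDl : left_distributive homWeyl_mul +%R.
Proof. by move=> p q r; rewrite /homWeyl_mul -raddfD -mulrDl. Qed.

Fact homWeyl_mulDr : right_distributive homWeyl_mul +%R.
Proof. by move=> p q r; rewrite /homWeyl_mul -raddfD -mulrDr. Qed.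

Fact homWeyl_mulZl c p q : homWeyl_mul (c *: p) q = c *: homWeyl_mul p q.
Proof. by rewrite /homWeyl_mul -linearZ scalerAl. Qed.

Fact homWeyl_mulZr c p q : homWeyl_mul p (c *: q) = c *: homWeyl_mul p q.
Proof. by rewrite /homWeyl_mul -linearZ scalerAr. Qed.

Fact homWeyl_twist_linear : linear (weyl_twist : homWeyl -> homWeyl).
Proof. exact: linearP. Qed.

Fact homWeyl_hom_assoc p q r :
  homWeyl_mul (weyl_twist p) (homWeyl_mul q r) =
  homWeyl_mul (homWeyl_mul p q) (weyl_twist r).
Proof. by rewrite /homWeyl_mul -!rmorphM mulrA. Qed.

HB.instance Definition _ := Lmodule_isHomAlgebra.Build K homWeyl
  homWeyl_mulDl homWeyl_mulDr homWeyl_mulZl homWeyl_mulZr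
  homWeyl_twist_linear homWeyl_hom_assoc.

End HomWeylAlgebra.

(* Main.v *)
(* Filter A_n by word length in the generators. On elements of length at most d,
   both ad g (g a generator) and alpha - 1 lower the length, and the Euler-type
   operator E a = \sum_i (y_i [x_i, a] - x_i [y_i, a]) is multiplication by d
   modulo shorter elements.
   - If I is an ideal of A_n^k and alpha a is in I, then so is
     alpha (alpha a - a), hence, by induction on the length, alpha a - a and a.
     Therefore I is an ideal of A_n.
   - A nonzero element of minimal length d in an ideal of A_n commutes with all
     generators, hence is killed by E; in characteristic zero this forces d = 0,
     that is, the element is a scalar. *)
Require Import Defs.
From HB Require Import structures.
From mathcomp Require Import all_boot all_order all_algebra.
From mathcomp Require Import boolp classical_sets.
From mathcomp.multinomials Require Import monalg.

Import GRing.Theory.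
Local Open Scope ring_scope.

(** * Commutators, and monomials of the free algebra *)

Definition comm {R : pzRingType} (a b : R) : R := a * b - b * a.

Lemma comm0 {R : pzRingType} (a : R) : comm a 0 = 0.
Proof. by rewrite /comm mulr0 mul0r subrr. Qed.

Lemma commD {R : pzRingType} (a b c : R) : comm a (b + c) = comm a b + comm a c.
Proof. by rewrite /comm mulrDr mulrDl opprD addrACA. Qed.

Lemma commM {R : pzRingType} (a b c : R) :
  comm a (b * c) = comm a b * c + b * comm a c.
Proof. by rewrite /comm mulrBl mulrBr !mulrA addrA subrK. Qed.

Lemma comm_alg {K : comPzRingType} {B : algType K} (a : B) (c : K) :
  comm a c%:A = 0.
Proof. by rewrite /comm mulr_algl mulr_algr subrr. Qed.

(** Makes basis monomials ring products, on which the morphism [weyl_pi] is computed factor by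
    factor. *)
Lemma free_monomE {K : comNzRingType} {T : choiceType} (w : {fmonom T}) :
  << 1 *g w >> = \prod_(t <- (w : seq T)) free_gen K t :> freeAlg K T.
Proof.
case: w => s; elim: s => [|t s IHs] /=.
  by rewrite big_nil -fmoneE.
rewrite big_cons -IHs freeAlg_mulE free_gen.unlock malgM_def fgmulUU mulr1.
have -> // : FMonom (t :: s) = mmul (fmu t) (FMonom s).
by apply/eqP; rewrite fmP fmM fmU.
Qed.

(** * The word-length filtration of A_n *)

Section Filtration.
Context (K : fieldType) (n : nat).
Local Notation A := (weyl K n).

Definition weyl_gen (t : 'I_n + 'I_n) : A :=
  match t with inl i => weyl_x K i | inr i => weyl_y K i end.

Lemma weyl_pi_gen t : weyl_pi (free_gen K t) = weyl_gen t.
Proof. by case: t => i; rewrite /= ?weyl_x.unlock ?weyl_y.unlock. Qed.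

Lemma weyl_gen_comm t u : exists s : K, comm (weyl_gen t) (weyl_gen u) = s%:A.
Proof.
case: t u => i [] j; rewrite /comm /=.
- by exists 0; rewrite weyl_xxC scale0r.
- by exists (i == j)%:R; rewrite weyl_xyC scaler_nat.
- by exists (- (j == i)%:R); rewrite scaleNr scaler_nat -weyl_xyC opprB.
- by exists 0; rewrite weyl_yyC scale0r.
Qed.

(* [weyl_fil d] is spanned by the words of length strictly less than [d]. *)
Inductive weyl_fil : nat -> A -> Prop :=
| weyl_fil0 d : weyl_fil d 0
| weyl_fil_alg d (c : K) : weyl_fil d.+1 c%:A
| weyl_fil_gen d t b : weyl_fil d b -> weyl_fil d.+1 (weyl_gen t * b)
| weyl_filD d a b : weyl_fil d a -> weyl_fil d b -> weyl_fil d (a + b).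

Lemma weyl_fil0P {a} : weyl_fil 0 a -> a = 0.
Proof.
move Ed: 0%N => d fa; elim: fa Ed => // {}d b c _ IHb _ IHc d0.
by rewrite IHb // IHc // addr0.
Qed.

Lemma weyl_filZ d c a : weyl_fil d a -> weyl_fil d (c *: a).
Proof.
elim=> [{}d|{}d c'|{}d t b _ IHb|{}d {}a b _ IHa _ IHb].
- by rewrite scaler0; constructor.
- by rewrite scalerA; constructor.
- by rewrite scalerAr; constructor.
- by rewrite scalerDr; constructor.
Qed.

Lemma weyl_filN d a : weyl_fil d a -> weyl_fil d (- a).
Proof. by rewrite -scaleN1r; exact: weyl_filZ. Qed.

Lemma weyl_filB d a b : weyl_fil d a -> weyl_fil d b -> weyl_fil d (a - b).
Proof. by move=> fa fb; apply: weyl_filD => //; exact: weyl_filN. Qed.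

Lemma weyl_fil_sum d (T : Type) (r : seq T) (f : T -> A) :
  (forall i, weyl_fil d (f i)) -> weyl_fil d (\sum_(i <- r) f i).
Proof. by move=> fP; elim/big_rec: _ => [|i b _]; constructor. Qed.

Lemma weyl_filS d a : weyl_fil d a -> weyl_fil d.+1 a.
Proof. by elim; constructor. Qed.

Lemma weyl_fil_leq d e a : (d <= e)%N -> weyl_fil d a -> weyl_fil e a.
Proof.
by move=> /subnK <-; elim: (e - d)%N => // m IHm /IHm; exact: weyl_filS.
Qed.

Lemma weyl_fil_word (s : seq ('I_n + 'I_n)) :
  weyl_fil (size s).+1 (\prod_(t <- s) weyl_gen t).
Proof.
elim: s => [|t s IHs]; first by rewrite big_nil -[1]scale1r; constructor.
by rewrite big_cons; constructor.
Qed.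

Lemma weyl_fil_exhaustive a : exists d, weyl_fil d a.
Proof.
elim/weyl_piPn: a => p; rewrite [p]monalgE raddf_sum /=.
elim/big_rec: _ => [|w b _ [d fb]]; first by exists 0%N; constructor.
exists (maxn (size (w : seq _)).+1 d); apply: weyl_filD; last first.
  by apply: weyl_fil_leq fb; exact: leq_maxr.
have -> : << p@_w *g w >> = p@_w *: (<< 1 *g w >> : freeAlg K ('I_n + 'I_n)%type).
  by apply/malgP => v; rewrite [RHS]mcoeffZ !mcoeffU mulrnAr mulr1.
rewrite linearZ free_monomE rmorph_prod; apply: weyl_filZ.
apply: weyl_fil_leq (leq_maxl _ _) _.
rewrite (eq_bigr weyl_gen) => [|t _]; last exact: weyl_pi_gen.
exact: weyl_fil_word.
Qed.

(** [comm (weyl_gen t)] is a derivation sending each letter to a scalar, so every term of the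
    Leibniz expansion of a word loses a letter. *)
Lemma weyl_fil_comm t d a :
  weyl_fil d a -> weyl_fil d.-1 (comm (weyl_gen t) a).
Proof.
elim=> [{}d|{}d c|{}d u b fb IHb|{}d {}a b _ IHa _ IHb].
- by rewrite comm0; constructor.
- by rewrite comm_alg; constructor.
- rewrite commM; have [s ->] := weyl_gen_comm t u; rewrite mulr_algl.
  (* The term with [comm _ b] lands in level [d.-1.+1], which is [d] only for positive [d]; at 0,
     [b] vanishes. *)
  case: d fb IHb => [/weyl_fil0P -> _|d fb IHb].
    by rewrite comm0 mulr0 scaler0 addr0; constructor.
  by apply: weyl_filD; [exact: weyl_filZ | constructor].
- by rewrite commD; constructor.
Qed.

(** * The Euler operator *)

(** On commutative symbols [[x_i, -]] is d/dy_i and [[y_i, -]] is -d/dx_i, so this is the Euler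
    vector field, whose eigenvalues are the degrees. *)
Definition euler (a : A) : A :=
  \sum_i (weyl_y K i * comm (weyl_x K i) a - weyl_x K i * comm (weyl_y K i) a).

Lemma eulerD a b : euler (a + b) = euler a + euler b.
Proof.
rewrite /euler -big_split; apply: eq_bigr => i _ /=.
by rewrite !commD !mulrDr opprD addrACA.
Qed.

Lemma euler0 : euler 0 = 0.
Proof. by rewrite /euler big1 // => i _; rewrite !comm0 !mulr0 subrr. Qed.

Lemma euler_alg c : euler c%:A = 0.
Proof. by rewrite /euler big1 // => i _; rewrite !comm_alg !mulr0 subrr. Qed.

Lemma euler_gen t : euler (weyl_gen t) = weyl_gen t.
Proof.
have yxC i j : weyl_y K i * weyl_x K j - weyl_x K j * weyl_y K i = - (j == i)%:R :> A.
  by rewrite -weyl_xyC opprB.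
case: t => j; rewrite /euler /comm /= (bigD1 j) //= big1 ?addr0 => [|i].
- by rewrite weyl_xxC yxC eqxx mulr0 mulrN1 sub0r opprK.
- by move=> /negPf neq_ij; rewrite weyl_xxC yxC eq_sym neq_ij oppr0 !mulr0 subr0.
- by rewrite weyl_yyC weyl_xyC eqxx mulr0 mulr1 subr0.
- by move=> /negPf neq_ij; rewrite weyl_yyC weyl_xyC neq_ij !mulr0 subr0.
Qed.

(** The correction to the Leibniz rule comes from moving [x_i] and [y_i] past [a]. When [a] is a
    generator, its commutators are scalars and the correction is short. *)
Lemma eulerM a b : euler (a * b) = euler a * b + a * euler b +
  \sum_i (comm (weyl_y K i) a * comm (weyl_x K i) b -
          comm (weyl_x K i) a * comm (weyl_y K i) b).
Proof.
have mul_commM (u v : A) : u * comm v (a * b) =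
    u * comm v a * b + a * (u * comm v b) + comm u a * comm v b.
  rewrite commM mulrDr !mulrA -addrA; congr (_ + _).
  by rewrite /comm [(u * a - _) * _]mulrBl [RHS]addrC subrK.
rewrite /euler mulr_suml mulr_sumr -!big_split; apply: eq_bigr => i _ /=.
rewrite !mul_commM [(_ * comm _ a - _) * _]mulrBl [a * (_ * comm _ b - _)]mulrBr.
by rewrite !opprD addrACA; congr (_ + _); rewrite addrACA.
Qed.

(** Level [d] stops at words of length [d.-1], hence this eigenvalue. *)
Lemma weyl_fil_euler d a :
  weyl_fil d a -> weyl_fil d.-1 (euler a - d.-1%:R *: a).
Proof.
elim=> [{}d|{}d c|{}d t b fb IHb|{}d {}a b _ IHa _ IHb].
- by rewrite euler0 scaler0 subrr; constructor.
- rewrite euler_alg sub0r; apply: weyl_filN.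
  (* Level 0 contains only 0, and there the factor [0%:R] kills the scalar. *)
  case: d => [|d] /=; first by rewrite scale0r; constructor.
  by apply: weyl_filZ; constructor.
- case: d fb IHb => [/weyl_fil0P -> _|d fb IHb].
    by rewrite mulr0 euler0 scaler0 subrr; constructor.
  rewrite /= in IHb *.
  (* By [euler_gen] the new letter contributes one copy of the word, raising the eigenvalue from [d]
     to [d.+1]. *)
  have -> : euler (weyl_gen t * b) - d.+1%:R *: (weyl_gen t * b) =
      weyl_gen t * (euler b - d%:R *: b) +
      \sum_i (comm (weyl_y K i) (weyl_gen t) * comm (weyl_x K i) b -
              comm (weyl_x K i) (weyl_gen t) * comm (weyl_y K i) b).
    rewrite eulerM euler_gen -natr1 scalerDl scale1r mulrBr -scalerAr opprD.
    rewrite [LHS]addrAC; congr (_ + _).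
    by rewrite [_ *: _ *- 1 + _]addrC addrACA subrr add0r.
  apply: weyl_filD; first by constructor.
  apply: weyl_fil_sum => i.
  have [s ->] := weyl_gen_comm (inr i) t.
  have [s' ->] := weyl_gen_comm (inl i) t.
  rewrite !mulr_algl; apply: weyl_filB; apply/weyl_filZ/weyl_filS.
    exact: (weyl_fil_comm (inl i) _ _ fb).
  exact: (weyl_fil_comm (inr i) _ _ fb).
- by rewrite eulerD scalerDr opprD addrACA; constructor.
Qed.

Lemma euler_eq0 a : (forall t, comm (weyl_gen t) a = 0) -> euler a = 0.
Proof.
move=> a0; rewrite /euler big1 // => i _.
by rewrite (a0 (inl i)) (a0 (inr i)) !mulr0 subrr.
Qed.

(** * Simplicity of A_n in characteristic zero *)

Lemma weyl_fil1P a : weyl_fil 1 a -> exists c : K, a = c%:A.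
Proof.
move Ed: 1%N => d fa; elim: fa Ed => [_ _|_ c _|{}d t b fb _ [d0]|{}d b b' _ IHb _ IHb' d1].
- by exists 0; rewrite scale0r.
- by exists c.
- by exists 0; move: fb; rewrite -d0 => /weyl_fil0P ->; rewrite mulr0 scale0r.
- have [[c ->] [c' ->]] := (IHb d1, IHb' d1).
  by exists (c + c'); rewrite scalerDl.
Qed.

Lemma weyl_ideal_full (charK0 : [pchar K] =i pred0) (I : set A) :
  is_ideal *%R I -> forall d a, weyl_fil d a -> I a -> a != 0 -> I = setT.
Proof.
move=> [_ IB IZ IM]; elim=> [|[|d] IHd] a fa Ia a_neq0.
- by move: a_neq0; rewrite (weyl_fil0P fa) eqxx.
- have [c aE] := weyl_fil1P _ fa.
  have c_neq0 : c != 0 by apply: contraNneq a_neq0 => c0; rewrite aE c0 scale0r.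
  have I1 : I 1 by rewrite -[1]scale1r -(mulVf c_neq0) -scalerA -aE; exact: IZ.
  by rewrite -subTset => b _; rewrite -[b]mulr1; exact: (IM b 1 I1).1.
have [[t ta_neq0]|] := pselect (exists t, comm (weyl_gen t) a <> 0).
  apply: IHd (weyl_fil_comm t _ _ fa) _ _; last exact/eqP.
  by have [? ?] := IM (weyl_gen t) a Ia; exact: IB.
(* Here [euler a] is 0, so [d.+1%:R *: a] itself drops a level. Levels 0 and 1 were split off so
   that this factor is invertible in characteristic zero. *)
move=> /forallNP a_central; apply: (IHd a) => //.
have := weyl_fil_euler _ _ fa.
rewrite euler_eq0 => [|t]; last exact: contrapT (a_central t).
rewrite sub0r => /weyl_filN; rewrite opprK => /(weyl_filZ _ d.+1%:R^-1).
by rewrite scalerA mulVf ?scale1r // (pcharf0P _).1.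
Qed.

(** * The twist and the ideals of A_n^k *)

Lemma weyl_twist_gen (k : 'rV[K]_n) t :
  exists s : K, weyl_twist k (weyl_gen t) = weyl_gen t + s%:A.
Proof.
case: t => i; first by exists 0; rewrite /= weyl_twist_x scale0r addr0.
by exists (k 0 i); rewrite /= weyl_twist_y.
Qed.

Lemma weyl_fil_twist (k : 'rV[K]_n) d a :
  weyl_fil d a -> weyl_fil d.-1 (weyl_twist k a - a).
Proof.
elim=> [{}d|{}d c|{}d t b fb IHb|{}d {}a b _ IHa _ IHb].
- by rewrite raddf0 subrr; constructor.
- by rewrite linearZ rmorph1 subrr; constructor.
- case: d fb IHb => [/weyl_fil0P -> _|d fb IHb].
    by rewrite mulr0 raddf0 subrr; constructor.
  rewrite rmorphM /=; have [s ->] := weyl_twist_gen k t.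
  (* The shift of the letter leaves [s] times the twist of [b], which is no longer than [b]. *)
  rewrite mulrDl mulr_algl addrAC -mulrBr.
  apply: weyl_filD; first by constructor.
  rewrite -[weyl_twist k b](subrK b); apply: weyl_filZ.
  by apply: weyl_filD => //; exact: weyl_filS.
- by rewrite raddfD opprD addrACA; constructor.
Qed.

End Filtration.

(** The twist minus the identity is nilpotent on each level, so the inverse twist is locally a
    polynomial in the twist, and stability under the twist passes to its inverse. *)
Lemma homWeyl_ideal_untwist (K : fieldType) (n : nat) (k : 'rV[K]_n)
    (I : set (homWeyl k)) :
  is_ideal hmul I -> forall a, I (weyl_twist k a) -> I a.
Proof.
move=> [I0 IB _ IM] a; have [d] := weyl_fil_exhaustive _ _ a.
elim: d a => [|d IHd] a fa Ita; first by rewrite (weyl_fil0P _ _ fa).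
(* Under [hmul], multiplying by the 1 of A_n applies the twist. *)
have Itta : I (weyl_twist k (weyl_twist k a)).
  by have [+ _] := IM (1 : weyl K n) _ Ita; rewrite /hmul /= /homWeyl_mul mul1r.
have : I (weyl_twist k a - a : weyl K n).
  apply: IHd; first exact: (weyl_fil_twist _ _ k _ _ fa).
  by rewrite raddfB; exact: IB.
by move=> /(IB _ _ Ita); rewrite subKr.
Qed.

(** Products under [hmul] are twisted products of A_n, so untwisting them gives stability under the
    product of A_n. *)
Lemma homWeyl_ideal_weyl (K : fieldType) (n : nat) (k : 'rV[K]_n)
    (I : set (homWeyl k)) :
  is_ideal hmul I -> is_ideal *%R (I : set (weyl K n)).
Proof.
move=> II; have untwist := homWeyl_ideal_untwist _ _ _ _ II.
case: II => [I0 IB IZ IM]; split=> // a b Ib.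
by have [? ?] := IM a b Ib; split; exact: untwist.
Qed.

Theorem theorem2 (K : fieldType) (charK0 : [pchar K] =i pred0) (n : nat)
  (n_ge1 : (1 <= n)%N) (k : 'rV[K]_n) : is_simple (homWeyl k).
Proof.
move=> I II; have [[a [Ia a_neq0]]|I_eq0] := pselect (exists a, I a /\ a <> 0).
  right; have [d fa] := weyl_fil_exhaustive _ _ (a : weyl K n).
  apply: (weyl_ideal_full _ _ charK0 _ (homWeyl_ideal_weyl _ _ _ _ II) _ _ fa Ia).
  exact/eqP.
left; apply/seteqP; split=> [a Ia|_ ->]; last by case: II.
by apply: contrapT => a_neq0; apply: I_eq0; exists a.
Qed.
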